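(* Let $k\geq 1$ be an integer and let $G$ be a graph of order $n$. If \[ \mu(G)>\frac{k}{2}+\sqrt{kn+\frac{k^2-4k}{4}}, \] then $G$ contains the cycle $C_{2l+2}$ as a subgraph for every $l=1,\ldots,k$.
   Context: All graphs are finite and simple. $\mu(G)$ denotes the largest eigenvalue of the adjacency matrix of $G$. $C_r$ denotes the cycle on $r$ vertices. *)

(* Defs.v *)
From HB Require Import structures.
From mathcomp Require Import all_boot all_order all_algebra.
From mathcomp Require Import reals.
Set Implicit Arguments. Unset Strict Implicit. Unset Printing Implicit Defensive.
Import Order.TTheory GRing.Theory Num.Theory.
Local Open Scope ring_scope.

Definition simple_graph (n : nat) (e : rel 'I_n) : Prop :=
  symmetric e /\ irreflexive e.

Definition adjmx (R : realType) (n : nat) (e : rel 'I_n) : 'M[R]_n :=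
  \matrix_(i, j) (e i j)%:R.

Definition is_largest_eigenvalue (R : realType) (n : nat) (A : 'M[R]_n) (mu : R) : Prop :=
  eigenvalue A mu /\ forall lam : R, eigenvalue A lam -> lam <= mu.

Definition contains_cycle (n : nat) (e : rel 'I_n) (m : nat) : Prop :=
  exists f : 'I_m -> 'I_n, injective f /\
    forall i j : 'I_m, val j = ((val i).+1 %% m)%N -> e (f i) (f j).

(* Main.v *)
Require Import Defs.
From HB Require Import structures.
From mathcomp Require Import all_boot all_order all_algebra.
From mathcomp Require Import reals.
From mathcomp Require Import zify ring lra.

(** Let [x] be an eigenvector for [mu] and [y = |x|], so that [A y >= mu y].  Put
    [S_i = 1^T A^i y].  If every vertex [u] satisfied
    [sum_(v ~ u) d(v) <= k d(u) + k (n - 1)], then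
    [mu S_1 <= S_2 <= k S_1 + k (n - 1) S_0], and with [S_1 >= mu S_0] this gives
    [mu^2 - k mu <= k (n - 1)], contrary to the hypothesis on [mu].  (Using [|x|]
    makes Perron's theorem unnecessary.)

    Fix a [u] violating the inequality, and let [A = N(u)] and [B] be the rest of
    the vertices other than [u].  It suffices to find a path on [2l + 1] vertices
    in [A u B] with both ends in [A] (an A-path), and we may discard the edges
    inside [B].  If there is no such path, then
    [sum_(v in A) d(v) <= (2l - 1) |A| + l |B|].  In a minimal counterexample every
    [b in B] has degree [> l] and every [a in A] satisfies [d(a) + d_A(a) >= 2l].
    An A-path on [p > 2] vertices contains one on [p - 2] vertices, hence every
    A-path of odd order has fewer than [2l + 1] vertices.  A longest A-path of even
    order [> 2l] is excluded by counting the neighbours of its first vertex; and if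
    all A-paths have at most [2l] vertices, the vertices of a longest one carry a
    cycle (Ore) and form a connected component, which can be deleted. *)

Ltac arith := repeat match goal with
  | H : ?P |- _ =>
    lazymatch P with
    | is_true (leq _ _) => fail
    | is_true (leq _ _ && leq _ _) => fail
    | is_true (odd _) => fail
    | is_true (~~ odd _) => fail
    | is_true (_ != _) => fail
    | _ = _ :> nat => fail
    | ?P => lazymatch type of P with Prop => clear H | _ => fail end
    end
  end; lia.

(** * Paths with both ends in [A]: cutting, rerouting and shortening them *)

Section APaths.
Set Implicit Arguments.
Unset Strict Implicit.

Variables (T : finType) (e : rel T) (A S : {set T}) (x0 : T).
Hypothesis e_sym : symmetric e.
Hypothesis e_irr : irreflexive e.
Hypothesis e_A : forall x y, e x y -> (x \in A) || (y \in A).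

(** The set [S] holds the vertices still present, so that an induction can delete vertices from it.
    Sizes count vertices, and a single vertex of [A] in [S] qualifies. *)
Definition apath (s : seq T) :=
  [&& 0 < size s, uniq s, sorted e s, all (mem S) s,
      head x0 s \in A & last x0 s \in A].

Local Notation v s i := (nth x0 s i).
Local Notation nbrs x := [set y in S | e x y].

Lemma sorted_cat_link (s1 s2 : seq T) :
  sorted e s1 -> sorted e s2 ->
  (0 < size s1 -> 0 < size s2 -> e (last x0 s1) (head x0 s2)) ->
  sorted e (s1 ++ s2).
Proof.
case: s1 => [|x s1] //= p1; case: s2 => [|y s2] /= p2; first by rewrite cats0.
by move=> /(_ isT isT) h; rewrite cat_path /= p1 h p2.
Qed.

Lemma sorted_rev_sym (s : seq T) : sorted e s -> sorted e (rev s).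
Proof.
by rewrite rev_sorted (eq_sorted (e' := e)) // => x y; rewrite e_sym.
Qed.

Lemma head_nth (s : seq T) : head x0 s = v s 0.
Proof. by rewrite nth0. Qed.

Lemma last_drop i (s : seq T) : i < size s -> last x0 (drop i s) = last x0 s.
Proof. by move=> h; rewrite -!nth_last nth_drop size_drop; congr nth; arith. Qed.

Lemma last_take i (s : seq T) : 0 < i <= size s -> last x0 (take i s) = v s i.-1.
Proof. by move=> h; rewrite -nth_last size_takel ?nth_take //; arith. Qed.

Lemma head_drop i (s : seq T) : head x0 (drop i s) = v s i.
Proof. by rewrite -nth0 nth_drop addn0. Qed.

Lemma head_take i (s : seq T) : 0 < i -> head x0 (take i s) = v s 0.
Proof. by move=> h; rewrite -nth0 nth_take. Qed.

Lemma head_rev (s : seq T) : head x0 (rev s) = last x0 s.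
Proof. by case/lastP: s => // s x; rewrite rev_rcons last_rcons. Qed.

Lemma edge_nth s i : sorted e s -> i.+1 < size s -> e (v s i) (v s i.+1).
Proof. by move=> /(sortedP x0); apply. Qed.

Lemma apath_rev s : apath s -> apath (rev s).
Proof.
case/and5P=> s0 us ss Ss /andP[hs ls].
rewrite /apath size_rev s0 rev_uniq us sorted_rev_sym // all_rev Ss /=.
by rewrite head_rev ls -head_rev revK.
Qed.

Lemma apath_drop s i : apath s -> i < size s -> v s i \in A -> apath (drop i s).
Proof.
case/and5P=> s0 us ss Ss /andP[hs ls] il vA.
rewrite /apath size_drop subn_gt0 il drop_uniq // drop_sorted //=.
rewrite head_drop vA last_drop // ls andbT andbT.
by apply/allP=> y /mem_drop; apply: (allP Ss).
Qed.

Lemma apath_take s i : apath s -> i < size s -> v s i \in A -> apath (take i.+1 s).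
Proof.
case/and5P=> s0 us ss Ss /andP[hs ls] il vA.
rewrite /apath size_takel // take_uniq // take_sorted //=.
rewrite head_take // -head_nth hs last_take ?vA ?andbT //.
by apply/allP=> y /mem_take; apply: (allP Ss).
Qed.

Lemma subseq_take_drop j i (s : seq T) : j <= i -> subseq (take j s ++ drop i s) s.
Proof.
move=> ji; rewrite -{3}(cat_take_drop i s); apply: cat_subseq => //.
by rewrite -(subnKC ji) takeD prefix_subseq.
Qed.

(** The new path runs backwards from [v s j.-1] to [v s 0], crosses over through [m] to [v s i], and
    follows [s] to its end. Positions [j] to [i - 1] are dropped. *)
Lemma apath_reroute s m i j : apath s -> 0 < j <= i -> i < size s ->
  v s j.-1 \in A -> path e (v s 0) (rcons m (v s i)) ->
  uniq m -> all (mem S) m -> ~~ has (mem s) m ->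
  apath (rev (take j s) ++ m ++ drop i s).
Proof.
case/and5P=> s0 us ss Ss /andP[hs ls] /andP[j0 ji] il vA pm um Sm ms.
have js : j <= size s by arith.
have pe : perm_eq (rev (take j s) ++ m ++ drop i s) (m ++ take j s ++ drop i s).
  by rewrite perm_catCA perm_cat2l perm_cat2r perm_rev.
have sb := subseq_take_drop s ji.
have di : drop i s = v s i :: drop i.+1 s by rewrite (drop_nth x0).
rewrite /apath (perm_size pe) (perm_uniq pe) (perm_all _ pe).
apply/and5P; split.
- by rewrite !size_cat size_takel //; arith.
- rewrite cat_uniq um (subseq_uniq sb us) andbT.
  apply: contra ms => /hasP[y /(mem_subseq sb) ys ym].
  by apply/hasP; exists y.
- case Er: (rev (take j s)) (sorted_rev_sym (take_sorted j ss)) => [|y t] /= yt.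
    by move: (size_rev (take j s)); rewrite Er size_takel //=; arith.
  have lt : last y t = v s 0.
    by rewrite -[RHS](head_take _ j0) -[take j s]revK head_rev Er.
  rewrite cat_path yt lt di -cat_rcons cat_path pm last_rcons /=.
  by have := drop_sorted i ss; rewrite di.
- rewrite all_cat Sm /=.
  by apply/allP=> y /(mem_subseq sb); apply: (allP Ss).
- rewrite catA last_cat.
  have -> z : last z (drop i s) = last x0 s by rewrite -(last_drop il) di.
  rewrite ls andbT; case Er: (rev (take j s)) => [|y t] /=.
    by move: (size_rev (take j s)); rewrite Er size_takel //=; arith.
  by rewrite -[y]/(head x0 (y :: t)) -Er head_rev last_take ?j0.
Qed.

Lemma size_reroute (s m : seq T) i j : 0 < j <= i -> i < size s ->
  size (rev (take j s) ++ m ++ drop i s) = j + size m + (size s - i).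
Proof.
by move=> ji il; rewrite !size_cat size_rev size_takel ?size_drop; arith.
Qed.

Lemma apath_cons s w : apath s -> w \in S -> w \in A -> w \notin s ->
  e w (v s 0) -> apath (w :: s).
Proof.
case: s => [|y s] // /and5P[_ us ss Ss /andP[_ ls]] wS wA ws ew.
apply/and5P; split=> //; first by rewrite cons_uniq ws.
- by rewrite /= ew.
- by rewrite /= wS.
- by apply/andP.
Qed.

Lemma apath_cons2 s x w : apath s -> w \in S -> w \notin s ->
  x \in S -> x \in A -> x \notin w :: s -> e x w -> e w (v s 0) ->
  apath (x :: w :: s).
Proof.
case: s => [|y s] // /and5P[_ us ss Ss /andP[_ ls]] wS ws xS xA xs ex ew.
apply/and5P; split=> //; first by rewrite 2!cons_uniq xs ws.
- by apply/and3P.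
- by apply/and3P.
- by apply/andP.
Qed.

(** If the third vertex from either end is in [A], two vertices are cut off at that end. Otherwise
    [e_A] puts the second vertex from each end in [A], and one vertex is cut off at both ends. *)
Lemma apath_peel s : apath s -> 2 < size s ->
  exists2 s', apath s' & size s' = size s - 2.
Proof.
move=> Ps s2; case: (boolP (v s 2 \in A)) => [v2|v2].
  by exists (drop 2 s); rewrite ?size_drop //; apply: apath_drop.
case: (boolP (v s (size s - 3) \in A)) => [v3|v3].
  exists (take (size s - 3).+1 s); last by rewrite size_takel //; arith.
  by apply: apath_take => //; arith.
have [_ _ ss _ _] := and5P Ps.
have v1 : v s 1 \in A.
  by have /e_A := edge_nth (i := 1) ss s2; rewrite (negPf v2) orbF.
have vl : v s (size s - 2) \in A.
  have : e (v s (size s - 3)) (v s (size s - 2)).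
    have := @edge_nth s (size s - 3) ss.
    have -> : (size s - 3).+1 = size s - 2 by arith.
    by apply; arith.
  by move/e_A; rewrite (negPf v3).
have P1 : apath (drop 1 s) by apply: apath_drop => //; arith.
have := @apath_take (drop 1 s) (size s - 3) P1.
rewrite size_drop nth_drop; have -> : 1 + (size s - 3) = size s - 2 by arith.
move=> h; exists (take (size s - 3).+1 (drop 1 s)); first by apply: h => //; arith.
by rewrite size_takel ?size_drop; arith.
Qed.

Lemma apath_odd_shrink s m : apath s -> odd m -> odd (size s) -> m <= size s ->
  exists2 s', apath s' & size s' = m.
Proof.
have [k] := ubnP (size s); elim: k s => // k IH s sk Ps om os ms.
have [<-|ne] := eqVneq (size s) m; first by exists s.
have s2 : 2 < size s by arith.
have [t Pt st] := apath_peel Ps s2.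
by apply: (IH t) => //; rewrite ?st; arith.
Qed.

(** * Opening cycles into A-paths, and a pigeonhole on positions *)

Lemma apath_of_cycle c : uniq c -> cycle e c -> all (mem S) c -> 0 < size c ->
  head x0 c \in A -> last x0 c \in A -> apath c.
Proof.
rewrite /apath => -> cc -> -> -> ->; rewrite !andbT /=.
by case: c cc => //= x p; rewrite rcons_path => /andP[].
Qed.

Lemma cycle_nth c i : cycle e c -> i.+1 < size c -> e (v c i) (v c i.+1).
Proof.
move=> cc; apply: edge_nth; case: c cc => //= x p.
by rewrite rcons_path => /andP[].
Qed.

Lemma apath_rot_cycle c i : uniq c -> cycle e c -> all (mem S) c ->
  i.+1 < size c -> v c i \in A -> v c i.+1 \in A -> apath (rot i.+1 c).
Proof.
move=> uc cc Sc ic vi vi1; apply: apath_of_cycle.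
- by rewrite rot_uniq.
- by rewrite rot_cycle.
- by apply/allP=> y; rewrite mem_rot; apply: (allP Sc).
- by rewrite size_rot (leq_trans _ ic).
- by rewrite /rot (drop_nth x0 ic).
- rewrite /rot last_cat.
  have : last x0 (take i.+1 c) \in A by rewrite last_take //= ltnW.
  case E: (take i.+1 c) => [|y t] //=.
  by move: (size_takel (ltnW ic)); rewrite E.
Qed.

(** An odd cycle cannot alternate between [A] and its complement, so by [e_A] some edge has both
    ends in [A]; removing that edge leaves an A-path on all the vertices. *)
Lemma apath_odd_cycle c : uniq c -> cycle e c -> all (mem S) c -> odd (size c) ->
  exists2 s, apath s & size s = size c.
Proof.
move=> uc cc Sc oc.
case: (boolP [exists i : 'I_(size c),
               [&& i.+1 < size c, v c i \in A & v c i.+1 \in A]]).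
  case/existsP=> i /and3P[ic vi vi1]; exists (rot i.+1 c); rewrite ?size_rot //.
  exact: apath_rot_cycle.
move=> /existsPn noAA.
have alt i : i < size c -> (v c i \in A) = (v c 0 \in A) (+) odd i.
  elim: i => [|i IH] ic; first by rewrite addbF.
  have := noAA (Ordinal (ltnW ic)); rewrite /= ic /=.
  have /e_A := cycle_nth cc ic; rewrite (IH (ltnW ic)).
  by case: (v c i.+1 \in A); case: (v c 0 \in A); case: (odd i).
have s0 : 0 < size c by arith.
(* The last index is even, so the alternation gives both ends of the closing edge the same status,
   and [e_A] then puts them in [A]. *)
have lc : (last x0 c \in A) = (v c 0 \in A).
  by rewrite -nth_last alt ?prednK // -subn1 oddB // oc addbF.
exists c => //; apply: apath_of_cycle => //; rewrite ?lc ?head_nth.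
all: case: c cc s0 lc {uc Sc oc noAA alt} => //= x p.
all: by rewrite rcons_path => /andP[_ /e_A +] _ lc; rewrite lc orbb.
Qed.

(** Pigeonhole: the first [2m] positions fall into [m] pairs of consecutive ones, and halving the
    index names the pair. *)
Lemma consecutive_in (N : {set T}) (s : seq T) m : {subset N <= s} ->
  (forall x, x \in N -> index x s < m.*2) -> m < #|N| ->
  exists2 i, i.+1 < size s & (v s i \in N) && (v s i.+1 \in N).
Proof.
move=> Ns Nm mN.
case: (boolP [exists i : 'I_(size s),
               [&& i.+1 < size s, v s i \in N & v s i.+1 \in N]]).
  by case/existsP=> i /andP[i1 iN]; exists i.
move/existsPn=> no; suff: #|N| <= m by rewrite leqNgt mN.
rewrite -(size_iota 0 m) cardE -(size_map (fun x => (index x s)./2)).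
apply: uniq_leq_size; last first.
  move=> _ /mapP[x xN ->]; rewrite mem_enum in xN; rewrite mem_iota /=.
  by have := Nm x xN; arith.
rewrite map_inj_in_uniq ?enum_uniq // => x y; rewrite !mem_enum => xN yN.
wlog: x y xN yN / index x s <= index y s.
  by move=> h; case/orP: (leq_total (index x s) (index y s)) => le ?;
     [|apply/esym]; apply: h.
move=> le /= eqh; have := Ns x xN; have := Ns y yN => ys xs.
have [eqi|ne] := eqVneq (index x s) (index y s).
  by rewrite -(nth_index x0 xs) eqi nth_index.
have iy : index y s = (index x s).+1 by arith.
have xl : index x s < size s by rewrite index_mem.
have := no (Ordinal xl).
by rewrite /= -iy index_mem ys !nth_index // xN yN.
Qed.

(** * Structure forced by the degree conditions of a minimal counterexample; [k] stands for the [l]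
    of the cycle length *)

Section Dense.

Variable k : nat.
Hypothesis k_gt0 : 0 < k.
Hypothesis no_apath : forall s, apath s -> size s != k.*2.+1.
Hypothesis degB : forall b, b \in S -> b \notin A -> k < #|nbrs b|.
Hypothesis degA : forall a, a \in S -> a \in A ->
  k.*2 <= #|nbrs a| + #|nbrs a :&: A|.

Lemma odd_apath_small s : apath s -> odd (size s) -> size s <= k.*2.
Proof.
move=> Ps os; rewrite leqNgt; apply/negP=> ks.
have [|t Pt st] := apath_odd_shrink Ps _ os ks; first by rewrite /= odd_double.
by move: (no_apath Pt); rewrite st eqxx.
Qed.

Lemma odd_cycle_small c : uniq c -> cycle e c -> all (mem S) c -> odd (size c) ->
  size c <= k.*2.
Proof.
move=> uc cc Sc oc; have [s Ps ss] := apath_odd_cycle uc cc Sc oc.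
by rewrite -ss odd_apath_small // ss.
Qed.

(* Any two consecutive neighbours of [w] on [s] would let [w] be inserted into
   a path of [size s + 1] vertices, so the first [2k] vertices of [s] contain
   at most [k] of them. *)
Lemma offpath_nbr_far s w : apath s ->
  (forall t, apath t -> size t != (size s).+1) ->
  (forall t, apath t -> size t != (size s).+2) ->
  w \in S -> w \notin s -> w \notin A -> e (v s 0) w ->
  exists2 i, k.*2 <= i < size s & e w (v s i).
Proof.
move=> Ps no1 no2 wS ws wA ew.
have nA x : e w x -> x \in A by move/e_A; rewrite (negPf wA).
have Ns : {subset nbrs w <= s}.
  move=> x; rewrite inE => /andP[xS ewx]; apply: contraT => xs.
  (* All neighbours of [w] are in [A] because [w] is not, so one off the path could become a new
     first vertex, followed by [w]. *)
  suff /no2 : apath (x :: w :: s) by rewrite eqxx.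
  apply: apath_cons2 => //; rewrite ?nA // 1?e_sym //.
  rewrite inE negb_or xs andbT; apply/eqP=> xw.
  by move: wA; rewrite -{1}xw nA.
case: (boolP [exists i : 'I_(size s), (k.*2 <= i) && e w (v s i)]).
  by case/existsP=> i /andP[ki ei]; exists i => //; rewrite ki ltn_ord.
move/existsPn=> near.
have [||i i1 /andP[vi vi1]] := @consecutive_in (nbrs w) s k Ns.
- move=> x xN; have xs := Ns x xN; move: xN; rewrite inE => /andP[_ ewx].
  have xl : index x s < size s by rewrite index_mem.
  by have := near (Ordinal xl); rewrite /= nth_index // ewx andbT ltnNge.
- exact: degB.
move: vi vi1; rewrite !inE => /andP[_ ei] /andP[_ ei1].
have Pt : apath (rev (take i.+1 s) ++ [:: w] ++ drop i.+1 s).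
  apply: apath_reroute => //=; rewrite ?ltnS ?leqnn ?nA //.
  - by rewrite ew ei1.
  - by rewrite wS.
  - by rewrite orbF.
have := no1 _ Pt; rewrite size_reroute ?ltnS ?leqnn //=.
by move/eqP; arith.
Qed.

Lemma sub_apath s : apath s -> {subset s <= S}.
Proof. by case/and5P=> _ _ _ /allP. Qed.

Lemma cycle_sorted_link c : 0 < size c -> sorted e c ->
  e (last x0 c) (head x0 c) -> cycle e c.
Proof. by case: c => //= x p _ px ex; rewrite rcons_path px. Qed.

(* Let [s] be a longest A-path of even order.  The neighbours [v s i] of [v s 0]
   satisfy [0 < i < 2k] and, for [i >= 2], [v s (i - 2)] is not in [A] while
   [v s (i - 1)] is.  Hence the indices [i] of the neighbours and the indices
   [i - 1] of those in [A] are pairwise distinct: at most [2k - 1] in total,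
   against [degA]. *)
Lemma even_apath_extends s : apath s -> ~~ odd (size s) -> k.*2 < size s ->
  exists2 t, apath t & size t = (size s).+2.
Proof.
move=> Ps os ks.
case: (boolP [exists t : (size s).+2.-tuple T, apath t]).
  by case/existsP=> t Pt; exists t; rewrite ?size_tuple.
move/existsPn=> no; exfalso.
have no2 t : apath t -> size t != (size s).+2.
  move=> Pt; apply/eqP=> st; move: (no (Tuple (introT eqP st))).
  by rewrite /= Pt.
have no1 t : apath t -> size t != (size s).+1.
  move=> Pt; apply/eqP=> st; have := odd_apath_small Pt; rewrite st /= os.
  by move/(_ isT); rewrite leqNgt ltnW.
have [s0 us ss Ss /andP[hs ls]] := and5P Ps; rewrite head_nth in hs.
have SS := sub_apath Ps.
have Ns : {subset nbrs (v s 0) <= s}.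
  move=> w; rewrite inE => /andP[wS ew]; apply: contraT => ws.
  case: (boolP (w \in A)) => wA.
    suff /no1 : apath (w :: s) by rewrite eqxx.
    by apply: apath_cons; rewrite // e_sym.
  have [i /andP[ki il] ei] := offpath_nbr_far Ps no1 no2 wS ws wA ew.
  have vi : v s i \in A by move/e_A: ei; rewrite (negPf wA).
  (* Since [i >= 2k], an odd [i] closes an odd cycle on [w] and the first [i + 1] vertices, while an
     even [i] makes those vertices an A-path of odd order; both are too long. *)
  case: (boolP (odd i)) => oi.
    suff: (size (w :: take i.+1 s) <= k.*2) by rewrite /= size_takel //; arith.
    apply: odd_cycle_small.
    - rewrite cons_uniq take_uniq // andbT.
      by apply: contra ws; apply: mem_take.
    - have := take_sorted i.+1 ss; have := @last_take i.+1 s il.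
      have := @head_take i.+1 s isT; case: (take i.+1 s) (size_takel il) => // y t _.
      rewrite /= => -> lt pt.
      by rewrite e_sym ew rcons_path pt lt e_sym.
    - rewrite /= wS; apply/allP=> y /mem_take; exact: SS.
    - by rewrite /= size_takel //= oi.
  have := odd_apath_small (apath_take Ps il vi); rewrite size_takel //= oi.
  by move/(_ isT); rewrite leqNgt ltnS ki.
have v1 : 1 < size s -> v s 1 \notin A.
  move=> s1; apply/negP=> v1; have := odd_apath_small (apath_drop Ps s1 v1).
  by rewrite size_drop; arith.
have v2 i : i.+2 < size s -> e (v s 0) (v s i.+2) -> v s i \notin A.
  move=> il ei; apply/negP=> vi.
  (* Jumping from [v s 0] straight to [v s i.+2] skips only [v s i.+1], which leaves an A-path of
     odd order above [2k]. *)
  have := @apath_reroute s [::] i.+2 i.+1 Ps.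
  rewrite /= leqnSn => /(_ isT il vi); rewrite ei => /(_ isT isT isT isT) Pt.
  have := odd_apath_small Pt.
  have -> : size (rev (take i.+1 s) ++ drop i.+2 s) = size s - 1.
    by rewrite (@size_reroute s [::]) //= ; arith.
  by arith.
have v2' i : i.+2 < size s -> e (v s 0) (v s i.+2) -> v s i.+1 \in A.
  move=> il ei; have := v2 i il ei; have /e_A := edge_nth ss (ltnW il).
  by case: (v s i \in A).
have vk i : i < size s -> e (v s 0) (v s i) -> i < k.*2.
  move=> il ei; rewrite ltnNge; apply/negP=> ki.
  (* For even [i] the first [i + 1] vertices carry an odd cycle; for odd [i] the first [i] vertices
     form an A-path, since [v2'] puts [v s i.-1] in [A]. *)
  case: (boolP (odd i)) => oi; last first.
    have := @odd_cycle_small (take i.+1 s); rewrite size_takel //= oi.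
    rewrite ltnNge ki => h; suff: false by [].
    apply: h => //; first exact: take_uniq.
      apply: cycle_sorted_link; rewrite ?size_takel // ?take_sorted //.
      by rewrite head_take // last_take //= e_sym.
    by apply/allP=> y /mem_take; apply: SS.
  case: i il ei ki oi => [|[|i]] // il ei ki oi.
    by move: k_gt0 ki; arith.
  have := odd_apath_small (apath_take Ps (ltnW il) (v2' i il ei)).
  by rewrite size_takel ?(ltnW il) //; arith.
have Nidx x : x \in nbrs (v s 0) -> [/\ index x s < size s, 0 < index x s,
    index x s < k.*2, e (v s 0) (v s (index x s)) & v s (index x s) = x].
  move=> xN; have xs := Ns x xN; move: xN; rewrite inE => /andP[_ ex].
  have vx := nth_index x0 xs; have xl : index x s < size s by rewrite index_mem.
  split=> //; rewrite ?vx //; last by apply: vk; rewrite ?vx.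
  by rewrite lt0n; apply: contraTneq ex => i0; rewrite -vx i0 e_irr.
have NAidx x : x \in nbrs (v s 0) :&: A -> 1 < index x s.
  case/setIP=> /Nidx[xl x1 _ _ vx] xA; rewrite ltn_neqAle x1 andbT.
  by apply: contraTneq xA => i1; rewrite -vx -i1 v1 // i1.
have v0S : v s 0 \in S by apply: SS; apply: mem_nth.
have := degA v0S hs.
rewrite leqNgt => /negP[].
rewrite !cardE -(size_map (index^~ s)).
rewrite -(size_map (fun x => (index x s).-1) (enum (nbrs (v s 0) :&: A))).
rewrite -size_cat -(prednK (_ : 0 < k.*2)) ?double_gt0 // ltnS.
rewrite -(size_iota 1 k.*2.-1); apply: uniq_leq_size; last first.
  move=> j; rewrite mem_cat mem_iota add1n prednK ?double_gt0 //.
  case/orP=> /mapP[x]; rewrite mem_enum => xN ->.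
    by have [_ -> -> _ _] := Nidx x xN.
  have x1 := NAidx x xN; case/setIP: xN => /Nidx[_ _ xk _ _] _.
  by move: x1 xk; arith.
rewrite cat_uniq map_inj_in_uniq ?enum_uniq; last first.
  move=> x y; rewrite !mem_enum => xN yN eqi.
  have [_ _ _ _ <-] := Nidx x xN; have [_ _ _ _ <-] := Nidx y yN.
  by rewrite eqi.
rewrite map_inj_in_uniq ?enum_uniq ?andbT /=; last first.
  move=> x y; rewrite !mem_enum => xN yN eqi.
  have := NAidx x xN; have := NAidx y yN.
  case/setIP: xN => /Nidx[_ _ _ _ vx] _; case/setIP: yN => /Nidx[_ _ _ _ vy] _.
  move=> x1 y1; rewrite -vx -vy; congr nth; move: x1 y1 eqi; arith.
apply/hasPn=> _ /mapP[y yN ->]; rewrite mem_enum in yN.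
apply/negP=> /mapP[x]; rewrite mem_enum => xN.
have := NAidx y yN; case/setIP: yN => /Nidx[yl _ _ ey vy] yA.
have [xl x0' _ ex vx] := Nidx x xN.
move: yl ey vy xl x0' ex vx; move: (index x s) (index y s) => i [|[|j]] //.
move=> yl ey vy xl i0 ex vx _ /= ji; move: i i0 ji xl ex vx => [|[|i]] // _ [ji].
all: subst j => xl ex vx.
  by have := v1 xl; rewrite (v2' 0).
by have := v2 i.+1 yl ey; rewrite (v2' i).
Qed.

Lemma longest_apath s : apath s ->
  exists2 t, apath t & forall u, apath u -> size u <= size t.
Proof.
have [m] := ubnP (#|T| - size s); elim: m s => // m IH s sm Ps.
case: (boolP [exists n : 'I_#|T|.+1, [exists t : n.-tuple T, (size s < n) && apath t]]).
  case/existsP=> n /existsP[t /andP[sn Pt]]; apply: (IH t) => //.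
  by rewrite size_tuple; have := ltn_ord n; arith.
move/existsPn=> no; exists s => // t Pt; rewrite leqNgt; apply/negP=> st.
have tT : size t < #|T|.+1.
  by have [_ /card_uniqP <- _ _ _] := and5P Pt; rewrite ltnS max_card.
have /existsPn/(_ (in_tuple t)) := no (Ordinal tT).
by rewrite /= st Pt.
Qed.

(** A neighbour in [A] off the path would extend it, and one outside [A] would need a neighbour at
    position [2k] or later, which does not exist. *)
Lemma longest_nbrs s : apath s -> (forall t, apath t -> size t <= size s) ->
  size s <= k.*2 -> {subset nbrs (v s 0) <= s}.
Proof.
move=> Ps max sk w; rewrite inE => /andP[wS ew]; apply: contraT => ws.
case: (boolP (w \in A)) => wA.
  have /max : apath (w :: s) by apply: apath_cons; rewrite // e_sym.
  by rewrite /= ltnn.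
have [i] : exists2 i, k.*2 <= i < size s & e w (v s i); last first.
  by move=> /andP[ki il] _; move: (leq_ltn_trans ki il); rewrite ltnNge sk.
by apply: offpath_nbr_far => // t /max; apply: contraTneq => ->; rewrite -ltnNge.
Qed.

Lemma longest_nbrs_last s : apath s -> (forall t, apath t -> size t <= size s) ->
  size s <= k.*2 -> {subset nbrs (last x0 s) <= s}.
Proof.
move=> Ps max sk w; rewrite -head_rev head_nth -mem_rev; apply: longest_nbrs.
- exact: apath_rev.
- by rewrite size_rev.
- by rewrite size_rev.
Qed.

(* Both ends of [s] have at least [k] neighbours, all on [s], so Ore's crossing
   argument applies. *)
Lemma longest_cycle s : apath s -> (forall t, apath t -> size t <= size s) ->
  size s <= k.*2 -> exists2 c, perm_eq c s & cycle e c.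
Proof.
move=> Ps max sk.
have N0 := longest_nbrs Ps max sk; have N1 := longest_nbrs_last Ps max sk.
have SS := sub_apath Ps.
have [s0 us ss Ss /andP[hs ls]] := and5P Ps; rewrite head_nth in hs.
have degk a : a \in s -> a \in A -> k <= #|nbrs a|.
  move=> /SS aS aA; rewrite -leq_double.
  rewrite (leq_trans (degA aS aA)) // -addnn leq_add2l subset_leq_card //.
  exact: subsetIl.
have d0 : k <= #|nbrs (v s 0)| by apply: degk => //; apply: mem_nth.
have d1 : k <= #|nbrs (last x0 s)|.
  by apply: degk => //; rewrite -nth_last mem_nth // prednK.
case: (boolP [exists i : 'I_(size s),
   [&& i.+1 < size s, e (v s 0) (v s i.+1) & e (last x0 s) (v s i)]]).
  case/existsP=> i /and3P[i1 e0 e1].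
  exists (take i.+1 s ++ rev (drop i.+1 s)).
    by rewrite -[X in perm_eq _ X](cat_take_drop i.+1) perm_cat2l perm_rev.
  apply: cycle_sorted_link.
  - by rewrite size_cat size_takel // ltnW.
  - apply: sorted_cat_link; rewrite ?sorted_rev_sym ?drop_sorted ?take_sorted //.
    move=> _ _; rewrite last_take ?(ltnW i1) // head_rev last_drop //=.
    by rewrite e_sym.
  - have lr z : last z (rev (drop i.+1 s)) = v s i.+1.
      by rewrite (drop_nth x0 i1) rev_cons last_rcons.
    rewrite last_cat lr e_sym; case E: (take i.+1 s) => [|y t] /=.
      by move: (size_takel (ltnW i1)); rewrite E.
    by rewrite -[y]/(head x0 (y :: t)) -E head_take.
move/existsPn=> no; exfalso.
have I0 x : x \in nbrs (v s 0) ->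
    [/\ index x s < size s, 0 < index x s & v s (index x s) = x].
  move=> xN; have xs := N0 x xN; move: xN; rewrite inE => /andP[_ ex].
  have vx := nth_index x0 xs; split; rewrite ?index_mem //.
  by rewrite lt0n; apply: contraTneq ex => i0; rewrite -vx i0 e_irr.
have I1 x : x \in nbrs (last x0 s) ->
    index x s < (size s).-1 /\ v s (index x s) = x.
  move=> xN; have xs := N1 x xN; move: xN; rewrite inE => /andP[_ ex].
  have vx := nth_index x0 xs; split=> //.
  have : index x s != (size s).-1.
    by apply: contraTneq ex => i0; rewrite -vx i0 nth_last e_irr.
  have xl : index x s < size s by rewrite index_mem.
  by move: xl; arith.
(* Without crossing edges, the predecessors of neighbours of the first vertex and the neighbours of
   the last are disjoint sets of positions below [size s - 1]. *)
suff : k.*2 <= (size s).-1 by move: s0 sk; arith.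
rewrite -addnn (leq_trans (leq_add d0 d1)) // !cardE.
rewrite -(size_map (fun x => (index x s).-1)).
rewrite -(size_map (index^~ s) (enum (nbrs (last x0 s)))) -size_cat.
rewrite -(size_iota 0 (size s).-1); apply: uniq_leq_size; last first.
  move=> j; rewrite mem_cat mem_iota add0n /=.
  case/orP=> /mapP[x]; rewrite mem_enum => xN ->.
    by have [] := I0 x xN; arith.
  by have [] := I1 x xN.
rewrite cat_uniq map_inj_in_uniq ?enum_uniq; last first.
  move=> x y; rewrite !mem_enum => /I0[_ x1 vx] /I0[_ y1 vy] eqi.
  by rewrite -vx -vy; congr nth; move: x1 y1 eqi; arith.
rewrite map_inj_in_uniq ?enum_uniq ?andbT /=; last first.
  move=> x y; rewrite !mem_enum => /I1[_ vx] /I1[_ vy] eqi.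
  by rewrite -vx -vy eqi.
apply/hasPn=> _ /mapP[y yN ->]; rewrite mem_enum in yN.
apply/negP=> /mapP[x]; rewrite mem_enum => xN eqi.
have [xl x1 vx] := I0 x xN; have [yl vy] := I1 y yN.
move: xN yN; rewrite !inE => /andP[_ ex] /andP[_ ey].
have yl' : index y s < size s by move: yl; arith.
have := no (Ordinal yl').
rewrite /= vy ey andbT eqi prednK // vx xl ex //.
Qed.

Lemma sub_apath_cons y t : path e y t -> uniq (y :: t) -> {subset y :: t <= S} ->
  y \in A -> last y t \in A -> apath (y :: t).
Proof.
by move=> pt ut St yA lA; apply/and5P; split; rewrite // ?yA //; apply/allP.
Qed.

(** A longest A-path has at most [2k] vertices and carries a cycle [c]. An edge from [y] on [c] to
    [x] off [c] would yield a longer A-path, or an equally long one with an end that has a neighbour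
    off it. *)
Lemma small_component a : a \in S -> a \in A -> exists2 c : seq T,
  [/\ uniq c, 0 < size c <= k.*2 & {subset c <= S}] &
  forall x y, y \in c -> x \in S -> e y x -> x \in c.
Proof.
move=> aS aA.
have [|s Ps max] := @longest_apath [:: a]; first by rewrite /apath /= aS aA.
have sk : size s <= k.*2.
  rewrite leqNgt; apply/negP=> ks; case: (boolP (odd (size s))) => os.
    by have := odd_apath_small Ps os; rewrite leqNgt ks.
  by have [t /max + st] := even_apath_extends Ps os ks; rewrite st ltnNge leqnSn.
have [c pc cc] := longest_cycle Ps max sk.
have [s0 us _ _ _] := and5P Ps.
have sc := perm_size pc; have uc : uniq c by rewrite (perm_uniq pc).
have cS : {subset c <= S} by move=> y; rewrite (perm_mem pc); apply: sub_apath.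
rewrite -sc in max sk s0 *.
exists c; first by rewrite s0 sk.
move=> x y yc xS eyx; apply: contraT => xc.
have long t : apath t -> size t <= size c by exact: max.
have E0 t : apath t -> size t = size c -> {subset nbrs (v t 0) <= t}.
  by move=> Pt st; apply: longest_nbrs; rewrite ?st.
have E1 t : apath t -> size t = size c -> {subset nbrs (last x0 t) <= t}.
  by move=> Pt st; apply: longest_nbrs_last; rewrite ?st.
have [i0 t rt] := rot_to yc.
have ut : uniq (y :: t) by rewrite -rt rot_uniq.
have mt z : (z \in y :: t) = (z \in c) by rewrite -rt mem_rot.
have tS : {subset y :: t <= S} by move=> z; rewrite mt; apply: cS.
have st : (size t).+1 = size c by rewrite -(size_rot i0 c) rt.
have : cycle e (y :: t) by rewrite -rt rot_cycle.
rewrite /= rcons_path => /andP[pt elt].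
have xt : x \notin y :: t by rewrite mt.
have split_last : last y t \notin A -> exists t' z, t = rcons t' z.
  move=> lA; case/lastP: t {rt ut mt tS st pt xt} elt lA => [|t' z]; last first.
    by exists t', z.
  by rewrite e_irr.
case: (boolP (x \in A)) => xA.
  case: (boolP (last y t \in A)) => lA.
    have /long : apath (x :: y :: t).
      apply: sub_apath_cons => //=; first by rewrite e_sym eyx.
        by rewrite xt.
      by move=> z; rewrite inE => /predU1P[->|/tS].
    by rewrite /= st ltnn.
  (* Trading [z] for [x] keeps the length maximal, yet the new last vertex is adjacent to the
     omitted [z]. *)
  have [t' [z tz]] := split_last lA; subst t; rewrite last_rcons in elt lA.
  move: pt; rewrite rcons_path => /andP[pt' ez].
  have l'A : last y t' \in A by have := e_A ez; rewrite (negPf lA) orbF.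
  have [zt' ut'] : z \notin y :: t' /\ uniq (y :: t').
    by move: ut; rewrite -rcons_cons rcons_uniq => /andP[].
  have tz x' : x' \in y :: t' -> x' \in y :: rcons t' z.
    by move=> h; rewrite -rcons_cons mem_rcons in_cons h orbT.
  have zt : z \in y :: rcons t' z by rewrite -rcons_cons mem_rcons mem_head.
  have Px : apath (x :: y :: t').
    apply: sub_apath_cons => //; first by rewrite /= e_sym eyx.
      by rewrite cons_uniq ut' andbT; apply: contra xt; apply: tz.
    by move=> x'; rewrite inE => /predU1P[->|/tz/tS].
  have sx : size [:: x, y & t'] = size c by rewrite -st size_rcons.
  have := E1 _ Px sx z; rewrite /= inE ez tS // => /(_ isT).
  by rewrite inE (negPf zt') orbF => /eqP zx; move: xt; rewrite -zx zt.
have xnA z : e x z -> z \in A by move/e_A; rewrite (negPf xA).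
have yA : y \in A by apply: xnA; rewrite e_sym.
(* A neighbour [x'] off [c] would allow [x'] and [x] to be put before [y], at the cost of at most
   one vertex of [c]. *)
have Nx : {subset nbrs x <= c}.
  move=> x'; rewrite inE => /andP[x'S ex]; apply: contraT => x'c.
  have x'A := xnA _ ex.
  have [t' [pt' ut' tt' lA s']] : exists t', [/\ path e y t', uniq (y :: t'),
      {subset y :: t' <= y :: t}, last y t' \in A & size t <= (size t').+1].
    case: (boolP (last y t \in A)) => lA; first by exists t; split.
    have [t' [z tz]] := split_last lA; subst t; rewrite last_rcons in elt lA.
    move: pt; rewrite rcons_path => /andP[pt' ez]; exists t'; split=> //.
    - by move: ut; rewrite -rcons_cons rcons_uniq => /andP[].
    - by move=> u h; rewrite -rcons_cons mem_rcons in_cons h orbT.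
    - by have := e_A ez; rewrite (negPf lA) orbF.
    - by rewrite size_rcons.
  have xt' : x \notin y :: t' by apply: contra xt; apply: tt'.
  have x't' : x' \notin y :: t' by apply: contra x'c; rewrite -mt; apply: tt'.
  have /long : apath (x' :: x :: y :: t').
    apply: sub_apath_cons => //.
    - by rewrite /= e_sym ex e_sym eyx.
    - rewrite 2!cons_uniq ut' xt' inE negb_or x't' !andbT.
      by apply: contraNneq xA => <-.
    - by move=> u; rewrite inE => /predU1P[->|] //; rewrite inE => /predU1P[->|/tt'/tS].
  by rewrite /= -st !ltnS ltnNge s'.
(* More than [k] neighbours of [x] among at most [2k] positions include two consecutive ones, both
   in [A]. Opening [c] between them gives a longest A-path whose first vertex is adjacent to [x] off
   it. *)
have [||i ic /andP[]] := @consecutive_in (nbrs x) c k Nx.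
- by move=> z /Nx zc; apply: leq_trans sk; rewrite index_mem.
- exact: degB.
rewrite !inE => /andP[_ /xnA ci] /andP[_ exi].
have Pr : apath (rot i.+1 c).
  by have ci1 := xnA _ exi; apply: apath_rot_cycle => //; apply/allP.
have := E0 _ Pr (size_rot _ _) x.
rewrite -head_nth /rot (drop_nth x0 ic) /= inE xS e_sym exi => /(_ isT).
by rewrite -cat_cons -drop_nth // mem_rot (negPf xc).
Qed.

End Dense.

End APaths.

(** * The degree-sum bound, by deleting vertices *)

Section DegreeSum.
Set Implicit Arguments.
Unset Strict Implicit.

Variables (T : finType) (e : rel T) (A : {set T}) (x0 : T) (k : nat).
Hypothesis e_sym : symmetric e.
Hypothesis e_irr : irreflexive e.
Hypothesis e_A : forall x y, e x y -> (x \in A) || (y \in A).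
Hypothesis k_gt0 : 0 < k.

Local Notation deg S x := #|[set y in S | e x y]|.

Lemma apathS (S S' : {set T}) s :
  S' \subset S -> apath e A S' x0 s -> apath e A S x0 s.
Proof.
move=> /subsetP SS /and5P[s0 us ss Ss hl]; apply/and5P; split=> //.
by apply/allP=> y /(allP Ss); apply: SS.
Qed.

(** Accounts for the deletion of [X]: what remains, what the surviving vertices of [A] lose, and
    what the deleted ones carried. *)
Lemma degsum_split (S X : {set T}) : X \subset S ->
  \sum_(x in S :&: A) deg S x =
  \sum_(x in (S :\: X) :&: A) deg (S :\: X) x +
  \sum_(x in (S :\: X) :&: A) deg X x + \sum_(x in X :&: A) deg S x.
Proof.
move=> XS; rewrite (big_setID X) /= addnC -big_split /=; congr (_ + _).
  have -> : (S :&: A) :\: X = (S :\: X) :&: A by rewrite setIDAC.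
  apply: eq_bigr => x _; rewrite -(cardsID X) addnC; congr (_ + _).
    by apply: eq_card => y; rewrite !inE andbA.
  apply: eq_card => y; rewrite !inE andbC andbA; congr (_ && _).
  by case: (boolP (y \in X)) => // /(subsetP XS) ->.
apply: eq_bigl => x; rewrite !inE andbC; case: (boolP (x \in X)) => //=.
by move/(subsetP XS) => ->.
Qed.

Lemma degsum_set1 (S : {set T}) x : x \in S ->
  \sum_(y in (S :\ x) :&: A) deg [set x] y = #|[set y in S | e x y] :&: A|.
Proof.
move=> xS; transitivity (\sum_(y in (S :\ x) :&: A | e y x) 1).
  rewrite big_mkcondr; apply: eq_bigr => y _.
  case: ifP => eyx.
    apply/eqP/cards1P; exists x; apply/setP=> z; rewrite !inE.
    by case: eqP => // ->.
  apply/eqP; rewrite cards_eq0; apply/eqP/setP=> z; rewrite !inE.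
  by case: eqP => // ->.
rewrite sum1dep_card; apply: eq_card => y; rewrite !inE e_sym.
by have [->|] := eqVneq y x; rewrite ?e_irr ?andbF //= -!andbA (andbC (y \in A)).
Qed.

(** Induction on the size of [S]: a vertex violating [degB] or [degA] is deleted, and if there is
    none, a small component is. *)
Lemma degsum_bound (S : {set T}) :
  (forall s, apath e A S x0 s -> size s != k.*2.+1) ->
  \sum_(x in S :&: A) deg S x <= k.*2.-1 * #|S :&: A| + k * #|S :\: A|.
Proof.
have [m] := ubnP #|S|; elim: m S => // m IH S Sm no.
have cA (X : {set T}) : X \subset S -> #|S :&: A| = #|(S :\: X) :&: A| + #|X :&: A|.
  move=> XS; rewrite -(cardsID X (S :&: A)) addnC setIDAC; congr (_ + _).
  by rewrite setIAC (setIidPr XS).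
have cB (X : {set T}) : X \subset S -> #|S :\: A| = #|(S :\: X) :\: A| + #|X :\: A|.
  move=> XS; rewrite -(cardsID X (S :\: A)) addnC setDDl setUC -setDDl; congr (_ + _).
  by rewrite setIC setIDA (setIidPl XS).
(* It suffices that deleting the nonempty [X] costs no more than the share of [X] in the bound. *)
have step (X : {set T}) z : X \subset S -> z \in X ->
    \sum_(x in (S :\: X) :&: A) deg X x + \sum_(x in X :&: A) deg S x <=
      k.*2.-1 * #|X :&: A| + k * #|X :\: A| ->
    \sum_(x in S :&: A) deg S x <= k.*2.-1 * #|S :&: A| + k * #|S :\: A|.
  move=> XS zX dX; rewrite (degsum_split XS) (cA _ XS) (cB _ XS) -addnA !mulnDr addnACA.
  apply: leq_add dX; apply: IH; last first.
    by move=> s /(apathS (subsetDl S X)); apply: no.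
  have X0 : 0 < #|X| by apply/card_gt0P; exists z.
  by have := cardsID X S; rewrite (setIidPr XS); move: X0 Sm; arith.
case: (boolP [exists b in S :\: A, deg S b <= k]).
  case/existsP=> b /andP[/setDP[bS bA] db].
  have b0 : [set b] :&: A = set0.
    by apply/setP=> z; rewrite !inE; case: eqP => // ->; apply/negbTE.
  have b1 : #|[set b] :\: A| = 1.
    by rewrite -(cards1 b) -(cardsID A [set b]) b0 cards0.
  apply: (step [set b] b); rewrite ?sub1set ?set11 // degsum_set1 //.
  rewrite b0 b1 big_set0 cards0 muln0 muln1 addn0 add0n (leq_trans _ db) //.
  by rewrite subset_leq_card // subsetIl.
move/existsPn=> nob.
case: (boolP [exists a in S :&: A, deg S a + #|[set y in S | e a y] :&: A| < k.*2]).
  case/existsP=> a /andP[/setIP[aS aA] da].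
  have a1 : [set a] :&: A = [set a] by apply/setIidPl; rewrite sub1set.
  have a0 : [set a] :\: A = set0 by apply/eqP; rewrite setD_eq0 sub1set.
  apply: (step [set a] a); rewrite ?sub1set ?set11 // degsum_set1 //.
  rewrite a0 a1 big_set1 cards0 cards1 muln0 muln1 addn0 addnC.
  by move: da k_gt0; arith.
move/existsPn=> noa.
have [SA0|[a /setIP[aS aA]]] := set_0Vmem (S :&: A); first by rewrite SA0 big_set0.
have degB b : b \in S -> b \notin A -> k < deg S b.
  by move=> bS bA; have := nob b; rewrite !inE bS bA /= -ltnNge.
have degA x : x \in S -> x \in A ->
    k.*2 <= deg S x + #|[set y in S | e x y] :&: A|.
  by move=> xS xA; have := noa x; rewrite !inE xS xA /= -leqNgt.
have [c [uc /andP[c0 ck] cS] closed_c] :=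
  small_component e_sym e_irr e_A k_gt0 no degB degA aS aA.
pose X := [set x in c].
have XS : X \subset S by apply/subsetP=> x; rewrite inE; apply: cS.
have [z zc] : exists z, z \in c.
  by case: (c) c0 => // z ? _; exists z; rewrite mem_head.
apply: (step X z) => //; first by rewrite inE.
(* No edge joins [X] to the rest, so survivors lose nothing, and each vertex of [X] has degree at
   most [#|X| - 1 <= 2k - 1]. *)
rewrite big1 ?add0n => [|x /setIP[/setDP[xS xX] _]]; last first.
  apply/eqP; rewrite cards_eq0; apply/eqP/setP=> y; rewrite !inE.
  apply/negbTE/negP=> /andP[yc exy]; case/negP: xX.
  by rewrite inE (closed_c x y) // e_sym.
rewrite (leq_trans _ (leq_addr _ _)) // mulnC -sum_nat_const leq_sum // => x.
rewrite inE => /andP[xX _]; have cX : #|X| = size c by rewrite cardsE; apply/card_uniqP.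
have : deg S x < #|X|.
  apply: proper_card; apply/properP; split; last first.
    by exists x; rewrite // inE e_irr andbF.
  apply/subsetP=> y; rewrite !inE => /andP[yS exy].
  by rewrite inE in xX; apply: (closed_c y x).
by rewrite cX; move: ck k_gt0; arith.
Qed.

End DegreeSum.

(** * From a vertex with many 2-walks to a cycle through it *)

Lemma cycle_of_many_2walks (n : nat) (e : rel 'I_n) (u : 'I_n) (l : nat) :
  simple_graph e -> 0 < l ->
  l * #|[set v | e u v]| + l * n.-1 < \sum_(v | e u v) #|[set w | e v w]| ->
  contains_cycle e (2 * l + 2).
Proof.
move=> [e_sym e_irr] l0 big_sum.
pose A := [set v | e u v]; pose S := [set~ u].
pose e' := [rel x y | e x y && ((x \in A) || (y \in A))].
case: (boolP [exists s : l.*2.+1.-tuple 'I_n, apath e' A S u s]) => [|/existsPn no].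
  case/existsP=> s /and5P[_ us ss Ss /andP[hs ls]].
  have ucs : uniq (u :: s).
    by rewrite cons_uniq us andbT; apply/negP=> /(allP Ss); rewrite !inE eqxx.
  have sz : size (u :: s) = 2 * l + 2 by rewrite /= size_tuple; lia.
  have cyc : cycle e (u :: s).
    move: ss hs ls; case: (tval s) => [|x t] //=.
      by rewrite !inE e_irr.
    rewrite !inE => pt -> ; rewrite rcons_path e_sym => ->; rewrite andbT.
    by apply: sub_path pt => y z /andP[].
  exists (fun i => nth u (u :: s) i); split.
    by move=> i j /eqP; rewrite nth_uniq ?sz ?ltn_ord // => /eqP/val_inj.
  move=> i j ij; have [il|il] := ltnP i.+1 (2 * l + 2).
    by rewrite ij modn_small //; apply: cycle_nth; rewrite // sz.
  have il' : i.+1 = 2 * l + 2 by apply/eqP; rewrite eqn_leq il ltn_ord.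
  rewrite ij il' modnn /= -[nat_of_ord i]/(i.+1.-1) il' -sz nth_last /=.
  by move: cyc; rewrite /= rcons_path => /andP[].
have e'_sym : symmetric e' by move=> x y; rewrite /= e_sym orbC.
have e'_irr : irreflexive e' by move=> x; rewrite /= e_irr.
have e'_A x y : e' x y -> (x \in A) || (y \in A) by case/andP.
have no' s : apath e' A S u s -> size s != l.*2.+1.
  move=> Ps; apply/eqP=> st; move: (no (Tuple (introT eqP st))).
  by rewrite /= Ps.
have uA : u \notin A by rewrite inE e_irr.
have SA : S :&: A = A.
  by apply/setIidPr/subsetP=> x xA; rewrite !inE; apply: contraNneq uA => <-.
have cSA : #|A| + #|S :\: A| = n.-1.
  by rewrite -{1}SA cardsID cardsC1 card_ord.
have := degsum_bound e'_sym e'_irr e'_A l0 no'; rewrite SA.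
(* Each vertex of [A] loses exactly its edge to [u]. Adding [#|A|] back turns the coefficient
   [2l - 1] into [2l], and [cSA] turns the bound into [l * #|A| + l * n.-1]. *)
have -> : \sum_(x in A) #|[set y in S | e' x y]| =
    \sum_(v | e u v) #|[set w | e v w]| - #|A|.
  have -> F : \sum_(v | e u v) F v = \sum_(v in A) F v.
    by apply: eq_bigl => x; rewrite inE.
  rewrite -sum1_card -sumnB => [|x]; last first.
    by rewrite inE => ux; apply/card_gt0P; exists u; rewrite inE e_sym.
  apply: eq_bigr => x xA; rewrite (cardsD1 u [set w | e x w]).
  have -> : u \in [set w | e x w] by move: xA; rewrite !inE e_sym.
  rewrite add1n subn1 /=; apply: eq_card => y.
  by rewrite inE in xA; rewrite !inE /= xA andbT.
move=> bound; exfalso; move: bound big_sum; rewrite -/A -cSA.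
set s := \sum_(_ | _) _; move: (#|A|) (#|S :\: A|) => d f.
have -> : l.*2.-1 * d = (l * d + l * d) - d.
  by rewrite -subn1 mulnBl mul1n -addnn mulnDl.
have : d <= l * d by rewrite leq_pmull.
by rewrite mulnDr; clear; lia.
Qed.

(** * The spectral hypothesis yields a vertex with many 2-walks *)

Import Order.TTheory GRing.Theory Num.Theory.
Local Open Scope ring_scope.

Lemma many_2walks (R : realType) (n : nat) (e : rel 'I_n) (mu : R) (k : nat) :
  eigenvalue (adjmx R e) mu ->
  k%:R / 2 + Num.sqrt (k%:R * n%:R + (k%:R ^+ 2 - 4 * k%:R) / 4) < mu ->
  exists u, (k * #|[set v | e u v]| + k * n.-1 <
             \sum_(v | e u v) #|[set w | e v w]|)%N.
Proof.
move=> /eigenvalueP[x xA x0] mu_gt.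
pose y i : R := `|x 0 i|; pose d i : R := #|[set w | e i w]|%:R.
have y0 i : 0 <= y i by exact: normr_ge0.
have [i0 yi0] : exists i, 0 < y i.
  by have /rV0Pn[i xi] := x0; exists i; rewrite normr_gt0.
have n0 : (0 < n)%N by apply: leq_ltn_trans (ltn_ord i0).
have n1 : n%:R = n.-1%:R + 1 :> R by rewrite -{1}(prednK n0) -natr1.
have k0 : 0 <= k%:R :> R by exact: ler0n.
have m0 : 0 <= n.-1%:R :> R by exact: ler0n.
(* The radicand equals [k (n - 1) + (k / 2)^2], so its root is at least [k / 2]; squaring
   [mu - k / 2 > r] gives the second inequality. *)
have [mu_k mu_q] : k%:R < mu /\ k%:R * n.-1%:R < (mu - k%:R) * mu.
  move: mu_gt; rewrite n1; set D := (X in Num.sqrt X).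
  have D0 : 0 <= D by rewrite /D; nra.
  have := sqr_sqrtr D0; have := sqrtr_ge0 D; set r := Num.sqrt D => r0 rD.
  have rk : k%:R / 2 <= r by rewrite /D in rD; nra.
  by rewrite /D in rD; split; nra.
have mu0 : 0 < mu by lra.
have dE i : d i = \sum_j (e i j)%:R.
  rewrite /d -sum1_card natr_sum big_mkcond; apply: eq_bigr => j _.
  by rewrite inE; case: (e i j).
have Ay j : mu * y j <= \sum_i y i * (e i j)%:R.
  have := congr1 (fun M : 'rV_n => M 0 j) xA; rewrite !mxE => xAj.
  rewrite -(gtr0_norm mu0) /y -normrM -xAj (le_trans (ler_norm_sum _ _ _)) //.
  by apply: ler_sum => i _; rewrite mxE normrM normr_nat.
pose S0 : R := \sum_i y i; pose S1 := \sum_i d i * y i.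
pose S2 := \sum_i (\sum_j (e i j)%:R * d j) * y i.
have S0_gt0 : 0 < S0.
  rewrite /S0 (bigD1 i0) //= ltr_pwDl // sumr_ge0 // => i _; exact: y0.
have S01 : mu * S0 <= S1.
  rewrite /S0 mulr_sumr.
  apply: (@le_trans _ _ (\sum_j \sum_i y i * (e i j)%:R)).
    by apply: ler_sum => j _; apply: Ay.
  rewrite exchange_big /=.
  by apply: ler_sum => i _; rewrite -mulr_sumr dE mulrC.
have S12 : mu * S1 <= S2.
  rewrite /S1 /S2 mulr_sumr.
  under [X in _ <= X]eq_bigr do rewrite mulr_suml.
  rewrite exchange_big /=; apply: ler_sum => j _.
  rewrite mulrCA (le_trans (ler_wpM2l _ (Ay j))) ?ler0n // mulr_sumr.
  by apply: ler_sum => i _; rewrite le_eqVlt; apply/orP; left; apply/eqP; ring.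
case: (boolP [exists u, (k * #|[set v | e u v]| + k * n.-1 <
             \sum_(v | e u v) #|[set w | e v w]|)%N]) => [/existsP //|/existsPn no].
have S2_le : S2 <= k%:R * S1 + k%:R * n.-1%:R * S0.
  rewrite /S1 /S0 !mulr_sumr -big_split /=; apply: ler_sum => i _.
  rewrite mulrA -mulrDl ler_wpM2r //.
  have := no i; rewrite -leqNgt -(ler_nat R) natrD !natrM natr_sum; apply: le_trans.
  rewrite [X in _ <= X]big_mkcond; apply: ler_sum => j _.
  by case: (e i j); rewrite ?mul1r ?mul0r.
(* Together these give [k (n - 1) S0 < (mu - k) mu S0 <= (mu - k) S1], while [S12] and [S2_le] give
   [(mu - k) S1 <= k (n - 1) S0]. *)
have h1 : 0 <= (mu - k%:R) * (S1 - mu * S0) by apply: mulr_ge0; rewrite subr_ge0 // ltW.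
have h2 : 0 < ((mu - k%:R) * mu - k%:R * n.-1%:R) * S0 by rewrite mulr_gt0 // subr_gt0.
by exfalso; clear -S12 S2_le h1 h2; nra.
Qed.

Theorem theorem2 (R : realType) (k n : nat) (e : rel 'I_n) (mu : R) :
  (1 <= k)%N ->
  simple_graph e ->
  is_largest_eigenvalue (adjmx R e) mu ->
  mu > k%:R / 2 + Num.sqrt (k%:R * n%:R + (k%:R ^+ 2 - 4 * k%:R) / 4) ->
  forall l : nat, (1 <= l <= k)%N -> contains_cycle e (2 * l + 2).
Proof.
move=> _ Ge [mu_eig _] mu_gt l /andP[l0 lk].
(* The vertex found for [k] serves every [l <= k], as the lower bound on its 2-walks only weakens
   when [k] is replaced by [l]. *)
have [u hu] := many_2walks mu_eig mu_gt.
apply: (cycle_of_many_2walks Ge l0 (u := u)).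
by apply: leq_ltn_trans hu; rewrite leq_add // leq_mul2r lk orbT.
Qed.
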